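(* Let $(\mathbb V,\mathbb E,\mathbf P,\mathcal W)$ be a weighted Markovian graph satisfying assumption (A) (see context). The Kemeny constant $K(\mathbf P,\mathcal W)=\sum_{i,j\in\mathbb V}\boldsymbol\pi(i)\mathbf M(i,j)\boldsymbol\pi(j)$ satisfies $$K(\mathbf P,\mathcal W)=\mathrm{tr}(\mathbf Z)\cdot\boldsymbol\pi(\mathbf P\circ\mathbf W)\mathbf 1 .$$
   Context: Weighted Markovian graph $(\mathbb V,\mathbb E,\mathbf P,\mathcal W)$: $\mathbb V=\{1,\dots,n\}$; $\mathbb E\subseteq\mathbb V\times\mathbb V$; the graph is strongly connected; $\mathbf P$ is a row-stochastic $n\times n$ matrix with $\mathbf P(i,j)\ge 0$ for $(i,j)\in\mathbb E$ and $\mathbf P(i,j)=0$ otherwise, assumed irreducible and (unless otherwise stated) aperiodic. The weights $\mathcal W(i,j)$ (random, or deterministic as a special case) take values in $[\epsilon,\infty)$ for $(i,j)\in\mathbb E$, for some $\epsilon>0$, and are zero otherwise. Assumption (A): $\mathbf P$ has a unique stationary distribution $\boldsymbol\pi$ (a row vector), and $\mathbf W(i,j)=\mathbb E[\mathcal W(i,j)]<\infty$, $\mathbf W^{(2)}(i,j)=\mathbb E[\mathcal W(i,j)^2]<\infty$ for $(i,j)\in\mathbb E$. Let $(\hat X_k)_{k\ge0}$ be the Markov chain with transition matrix $\mathbf P$. For $\hat X_0=i$ let $\hat\tau(i,j)=\inf\{m\ge1:\hat X_m=j\}$ (first return time if $i=j$), and let $\tau(i,j)$ be the sum of the weights $\mathcal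 W(\hat X_{k-1},\hat X_k)$ over the transitions $k=1,\dots,\hat\tau(i,j)$; the weights are independent of the chain, so a traversal of edge $(a,b)$ has conditional mean weight $\mathbf W(a,b)$. Set $\mathbf M(i,j)=\mathbb E[\tau(i,j)]$. Notation: $\circ$ is the entrywise product; $\mathbf 1$ is the all-ones column vector; $\Pi=\mathbf 1\boldsymbol\pi$; $\mathbf Z=(\mathbf I-\mathbf P+\Pi)^{-1}$; $\mathrm{tr}$ is the trace. *)

(* Defs.v *)
From HB Require Import structures.
From mathcomp Require Import all_boot all_order all_algebra.
From mathcomp Require Import all_classical all_reals all_analysis.

Set Implicit Arguments.
Unset Strict Implicit.
Unset Printing Implicit Defensive.

Import Order.TTheory GRing.Theory Num.Theory.

Local Open Scope classical_set_scope.
Local Open Scope ring_scope.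

(* The vertex set {1,...,n} is represented by 'I_n. *)

Definition strongly_connected (n : nat) (E : {set 'I_n * 'I_n}) : Prop :=
  forall i j : 'I_n, connect [rel a b | (a, b) \in E] i j.

Definition irreducible_mx (R : realType) (n : nat) (P : 'M[R]_n) : Prop :=
  forall i j : 'I_n, exists2 k : nat, (0 < k)%N & 0 < (P ^+ k) i j.

(* gcd {k >= 1 | P^k(i,i) > 0} = 1 for every i: the only common divisor of
   these return lengths is 1. *)
Definition aperiodic_mx (R : realType) (n : nat) (P : 'M[R]_n) : Prop :=
  forall (i : 'I_n) (d : nat),
    (forall k : nat, (0 < k)%N -> 0 < (P ^+ k) i i -> (d %| k)%N) -> d = 1%N.

Definition stationary (R : realType) (n : nat) (P : 'M[R]_n) (p : 'rV[R]_n)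
    : Prop :=
  [/\ forall i, 0 <= p 0 i, \sum_i p 0 i = 1 & p *m P = p].

Definition weights_range (R : realType) (n : nat) (E : {set 'I_n * 'I_n})
    (eps : R) (T : Type) (w : 'I_n -> 'I_n -> T -> R) : Prop :=
  forall (i j : 'I_n) (t : T),
    ((i, j) \in E -> eps <= w i j t) /\ ((i, j) \notin E -> w i j t = 0).

Record weighted_markovian_graph (R : realType) (n : nat)
    (d : measure_display) (S : measurableType d) (Q : probability S R)
    (E : {set 'I_n * 'I_n}) (P : 'M[R]_n) (eps : R)
    (wt : 'I_n -> 'I_n -> {RV Q >-> R}) : Prop := WeightedMarkovianGraph {
  wmg_connected : strongly_connected E ;
  wmg_ge0 : forall i j, (i, j) \in E -> 0 <= P i j ;
  wmg_eq0 : forall i j, (i, j) \notin E -> P i j = 0 ;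
  wmg_row_sum : forall i, \sum_j P i j = 1 ;
  wmg_irreducible : irreducible_mx P ;
  wmg_aperiodic : aperiodic_mx P ;
  wmg_eps_gt0 : 0 < eps ;
  wmg_range : weights_range E eps wt }.

Record assumption_A (R : realType) (n : nat)
    (d : measure_display) (S : measurableType d) (Q : probability S R)
    (E : {set 'I_n * 'I_n}) (P : 'M[R]_n)
    (wt : 'I_n -> 'I_n -> {RV Q >-> R}) (p : 'rV[R]_n) : Prop := AssumptionA {
  asA_stationary : stationary P p ;
  asA_unique : forall q : 'rV[R]_n, stationary P q -> q = p ;
  asA_mean : forall i j, (i, j) \in E -> ('E_Q[wt i j] < +oo)%E ;
  asA_mean2 : forall i j, (i, j) \in E ->
    ('E_Q[(fun s => (wt i j s : R) ^+ 2)%R] < +oo)%E }.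

(* The defining property in product form
     Pr(X_0 = x_0, ..., X_{k+1} = x_{k+1})
       = Pr(X_0 = x_0, ..., X_k = x_k) P(x_k, x_{k+1}),
   so that no conditioning on null events occurs. *)
Record markov_chain_from (R : realType) (n : nat)
    (d : measure_display) (T : measurableType d) (Pr : probability T R)
    (P : 'M[R]_n) (i : 'I_n) (X : nat -> T -> 'I_n) : Prop := MarkovChainFrom {
  mc_measurable : forall (k : nat) (a : 'I_n), measurable (X k @^-1` [set a]) ;
  mc_init : Pr (X 0%N @^-1` [set i]) = 1%E ;
  mc_step : forall (k : nat) (x : nat -> 'I_n),
    Pr [set t | forall m, (m <= k.+1)%N -> X m t = x m] =
    (Pr [set t | forall m, (m <= k)%N -> X m t = x m] *
       (P (x k) (x k.+1))%:E)%E }.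

Definition chain_sigma (n : nat) (T : Type) (X : nat -> T -> 'I_n)
    : set (set T) :=
  <<s [set A | exists k a, A = X k @^-1` [set a]] >>.

Definition weights_sigma (R : realType) (n : nat) (T : Type)
    (w : nat -> 'I_n -> 'I_n -> T -> R) : set (set T) :=
  <<s [set A | exists k a b (B : set R),
         measurable B /\ A = w k a b @^-1` B] >>.

(* w k a b is the weight charged if the k-th transition (k >= 1) traverses
   (a, b): a copy of wt a b, with the whole array independent of the chain.
   No joint law over k, a, b is imposed, so the array may be resampled at each
   transition or be the same at all transitions. *)
Record weighted_chain_from (R : realType) (n : nat)
    (d : measure_display) (S : measurableType d) (Q : probability S R)
    (E : {set 'I_n * 'I_n}) (P : 'M[R]_n) (eps : R)
    (wt : 'I_n -> 'I_n -> {RV Q >-> R})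
    (d' : measure_display) (T : measurableType d') (Pr : probability T R)
    (i : 'I_n) (X : nat -> T -> 'I_n)
    (w : nat -> 'I_n -> 'I_n -> {mfun T >-> R}) : Prop := WeightedChainFrom {
  wc_chain : markov_chain_from Pr P i X ;
  wc_range : forall k, weights_range E eps (w k) ;
  wc_law : forall k a b (B : set R), measurable B ->
    Pr (w k a b @^-1` B) = Q (wt a b @^-1` B) ;
  wc_indep : forall A B : set T, chain_sigma X A -> weights_sigma w B ->
    Pr (A `&` B) = (Pr A * Pr B)%E }.

Definition hitting_time (R : realType) (n : nat) (T : Type)
    (X : nat -> T -> 'I_n) (j : 'I_n) (t : T) : \bar R :=
  ereal_inf [set (m%:R)%:E | m in [set m : nat | (1 <= m)%N /\ X m t = j]].

Definition weighted_hitting_time (R : realType) (n : nat) (T : Type)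
    (X : nat -> T -> 'I_n) (w : nat -> 'I_n -> 'I_n -> T -> R)
    (j : 'I_n) (t : T) : \bar R :=
  (\sum_(1 <= k <oo | ((k%:R)%:E <= hitting_time R X j t)%E)
     (w k (X k.-1 t) (X k t) t)%:E)%E.

Definition mean_first_passage (R : realType) (n : nat)
    (d : measure_display) (T : measurableType d) (Pr : 'I_n -> probability T R)
    (X : nat -> T -> 'I_n) (w : nat -> 'I_n -> 'I_n -> T -> R)
    (i j : 'I_n) : \bar R :=
  (\int[Pr i]_t weighted_hitting_time X w j t)%E.

Definition kemeny (R : realType) (n : nat) (p : 'rV[R]_n)
    (M : 'I_n -> 'I_n -> \bar R) : \bar R :=
  (\sum_i \sum_j (p 0 i)%:E * M i j * (p 0 j)%:E)%E.

Definition mean_weights (R : realType) (n : nat)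
    (d : measure_display) (S : measurableType d) (Q : probability S R)
    (wt : 'I_n -> 'I_n -> {RV Q >-> R}) : 'M[R]_n :=
  \matrix_(i, j) fine ('E_Q[wt i j])%E.

Definition ones (R : realType) (n : nat) : 'cV[R]_n := const_mx 1.

Definition fundamental_mx (R : realType) (n : nat) (P : 'M[R]_n)
    (p : 'rV[R]_n) : 'M[R]_n :=
  invmx (1%:M - P + ones R n *m p).

(* Main.v *)
Require Import Defs.
From HB Require Import structures.
From mathcomp Require Import all_boot all_order all_algebra.
From mathcomp Require Import all_classical all_reals all_analysis.
From mathcomp Require Import measurable_realfun ring lra.

Set Implicit Arguments.
Unset Strict Implicit.
Unset Printing Implicit Defensive.

Import Order.TTheory GRing.Theory Num.Theory.
Import numFieldNormedType.Exports.

Local Open Scope classical_set_scope.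
Local Open Scope ring_scope.

(** Write [r] for the vector [(P o W) 1] of the mean weights of one step, and
    [D_j] for [P] with column [j] replaced by zero ([killed]).

    The chain started at [i] is at [a] at time [k] without having passed
    through [j] at the times [1, ..., k] with probability [(D_j ^ k)(i, a)]
    ([avoid_prob]). The weights are independent of the chain, so the weight
    collected at time [k + 1], if that is at most the passage time to [j], has
    mean [(D_j ^ k r)(i)]. Summing over [k] by monotone convergence,
    [M(., j) = sum_k D_j ^ k r], and this Neumann series converges to
    [(1 - D_j)^-1 r] because [D_j ^ k] tends to zero for an irreducible [P]
    ([mean_first_passageE], [killed_series_cvg]). Hence the column
    [y_j = M(., j)] is finite and solves [y_j = r + D_j y_j].

    The rest is linear algebra ([first_passage_stationary]). Since
    [D_j y = P y - y(j) P e_j], the equation reads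
    [(1 - P) y_j = r - y_j(j) P e_j]. Multiplying it by [p] on the left gives
    [y_j(j) p(j) = p r]; multiplying it by [Z] gives, at coordinate [j],
    [p y_j = y_j(j) Z(j, j) + y_j(j) p(j) - (Z r)(j)]. Therefore
    [p(j) (p y_j) = (p r) Z(j, j) + (p r) p(j) - p(j) (Z r)(j)], and in the sum
    over [j] the last two terms cancel since [p 1 = 1] and [p Z = p], which
    leaves [tr(Z) (p r)]. *)

(** * Irreducible stochastic matrices *)

Definition stochastic (R : realType) (n : nat) (P : 'M[R]_n) : Prop :=
  (forall i j, 0 <= P i j) /\ P *m ones R n = ones R n.

Lemma row_sum_stochastic (R : realType) (n : nat) (P : 'M[R]_n) :
  stochastic P -> forall i, \sum_j P i j = 1.
Proof.
move=> [_ P1] i; have := congr1 (fun A : 'cV_n => A i 0) P1.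
by rewrite !mxE => <-; apply: eq_bigr => j _; rewrite mxE mulr1.
Qed.

Lemma stochastic_row_sum (R : realType) (n : nat) (P : 'M[R]_n) :
  (forall i j, 0 <= P i j) -> (forall i, \sum_j P i j = 1) -> stochastic P.
Proof.
move=> P0 P1; split=> //; apply/colP => i; rewrite !mxE -(P1 i).
by apply: eq_bigr => j _; rewrite mxE mulr1.
Qed.

Lemma mxpow_ge0 (R : realType) (n : nat) (A : 'M[R]_n) :
  (forall i j, 0 <= A i j) -> forall k i j, 0 <= (A ^+ k) i j.
Proof.
move=> A0; elim=> [|k IH] i j; first by rewrite expr0 mxE ler0n.
by rewrite exprS -mulmxE mxE; apply: sumr_ge0 => a _; apply: mulr_ge0.
Qed.

Lemma mxpow_fixed (R : realType) (n : nat) (A : 'M[R]_n) (x : 'cV[R]_n) :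
  A *m x = x -> forall k, A ^+ k *m x = x.
Proof.
move=> Ax; elim=> [|k IH]; first by rewrite expr0 mul1mx.
by rewrite exprS -mulmxE -mulmxA IH.
Qed.

Lemma mxpow_fixed_row (R : realType) (n : nat) (A : 'M[R]_n) (p : 'rV[R]_n) :
  p *m A = p -> forall k, p *m A ^+ k = p.
Proof.
move=> pA; elim=> [|k IH]; first by rewrite expr0 mulmx1.
by rewrite exprS -mulmxE mulmxA pA.
Qed.

Lemma stochastic_exp (R : realType) (n : nat) (P : 'M[R]_n) :
  stochastic P -> forall k, stochastic (P ^+ k).
Proof. by move=> [P0 P1] k; split; [exact: mxpow_ge0 | exact: mxpow_fixed]. Qed.

(** The maximum principle. At a vertex where [x] is maximal, [x] is a weighted
    average of values that do not exceed it, so it takes the same value at each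
    vertex reached with positive probability, and irreducibility reaches all
    of them. *)
Lemma harmonic_const (R : realType) (n : nat) (P : 'M[R]_n) :
  stochastic P -> irreducible_mx P ->
  forall x : 'cV[R]_n, P *m x = x -> forall i j, x i 0 = x j 0.
Proof.
move=> sP irrP x Px.
suff top (i0 : 'I_n) : exists m, forall j, x j 0 = x m 0.
  by move=> i j; have [m xm] := top i; rewrite !xm.
exists [arg max_(i > i0) x i 0]%O; case: arg_maxP => // m _ xmax j.
have [k k0 Pk] := irrP m j.
have [Q0 Q1] := stochastic_exp sP k.
have /row_sum_stochastic Qs : stochastic (P ^+ k) by split.
have Qx := congr1 (fun A : 'cV_n => A m 0) (mxpow_fixed Px k).
have gap0 : \sum_a (P ^+ k) m a * (x m 0 - x a 0) = 0.
  under eq_bigr do rewrite mulrBr.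
  by rewrite sumrB -mulr_suml Qs mul1r -[X in X - _]Qx mxE subrr.
have gap_ge0 a : true -> 0 <= (P ^+ k) m a * (x m 0 - x a 0).
  by move=> _; apply: mulr_ge0 => //; rewrite subr_ge0; exact: xmax.
have /eqP := psumr_eq0P gap_ge0 gap0 (isT : xpredT j).
by rewrite mulf_eq0 gt_eqF //= subr_eq0 => /eqP.
Qed.

(** Some [p i] is positive, [i] leads to [j] in some number [k] of steps, and
    [p] is also stationary for [P ^+ k]. *)
Lemma stationary_gt0 (R : realType) (n : nat) (P : 'M[R]_n) (p : 'rV[R]_n) :
  stochastic P -> irreducible_mx P -> stationary P p -> forall j, 0 < p 0 j.
Proof.
move=> [P0 _] irrP [p0 p1 pP] j.
have /existsP[i pi] : [exists i, 0 < p 0 i].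
  apply: contraT; rewrite negb_exists => /forallP pN.
  have : \sum_i p 0 i = 0.
    by apply: big1 => i _; apply/eqP; rewrite eq_le p0 leNgt pN.
  by rewrite p1 => /eqP; rewrite oner_eq0.
have [k _ Pk] := irrP i j.
rewrite -(mxpow_fixed_row pP k) mxE (bigD1 i) //=.
apply: ltr_pwDl; first exact: mulr_gt0.
by apply: sumr_ge0 => a _; apply: mulr_ge0 => //; apply: mxpow_ge0.
Qed.

Lemma stationary_ones (R : realType) (n : nat) (P : 'M[R]_n) (p : 'rV[R]_n) :
  stationary P p -> p *m ones R n = 1%:M.
Proof.
move=> [_ p1 _]; apply/matrixP => i j; rewrite !ord1 !mxE mulr1n -p1.
by apply: eq_bigr => k _; rewrite mxE mulr1.
Qed.

Lemma unitmx_inj_col (F : fieldType) (n : nat) (A : 'M[F]_n) :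
  (forall x : 'cV[F]_n, A *m x = 0 -> x = 0) -> A \in unitmx.
Proof.
move=> Ainj; rewrite -unitmx_tr -row_free_unit; apply/inj_row_free => v vA.
apply: trmx_inj; rewrite trmx0; apply: Ainj.
by rewrite -[A]trmxK -trmx_mul vA trmx0.
Qed.

(** Harmonic vectors are multiples of [ones], and [p] is not orthogonal to
    [ones]. *)
Lemma harmonic_centered_eq0 (R : realType) (n : nat) (P : 'M[R]_n)
    (p : 'rV[R]_n) :
  stochastic P -> irreducible_mx P -> stationary P p ->
  forall x : 'cV[R]_n, P *m x = x -> p *m x = 0 -> x = 0.
Proof.
move=> sP irrP stp x Px px; apply/colP => i; rewrite [RHS]mxE.
have xE : x = x i 0 *: ones R n.
  apply/colP => j; rewrite !mxE [RHS]mulr1.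
  exact: (harmonic_const sP irrP Px).
have := px; rewrite xE -scalemxAr (stationary_ones stp) => /matrixP/(_ 0 0).
by rewrite !mxE eqxx mulr1n !mulr1.
Qed.

(** A vector [x] in the kernel satisfies [p *m x = 0], as seen by multiplying
    by [p] on the left, hence [P *m x = x]. *)
Lemma fundamental_unit (R : realType) (n : nat) (P : 'M[R]_n) (p : 'rV[R]_n) :
  stochastic P -> irreducible_mx P -> stationary P p ->
  1%:M - P + ones R n *m p \in unitmx.
Proof.
move=> sP irrP stp; have [_ _ pP] := stp.
apply: unitmx_inj_col => x Ax0.
have px : p *m x = 0.
  have := congr1 (mulmx p) Ax0; rewrite mulmx0 mulmxA mulmxDr mulmxBr mulmx1 pP.
  by rewrite subrr add0r (mulmxA p) (stationary_ones stp) mul1mx.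
apply: (harmonic_centered_eq0 sP irrP stp) => //; apply/esym/eqP.
move: Ax0; rewrite mulmxDl mulmxBl mul1mx -mulmxA px mulmx0 addr0.
by move/eqP; rewrite subr_eq0.
Qed.

(** * The chain killed at a vertex *)

Lemma cvg_fin_sum (R : realType) (I : finType) (f : I -> R^nat) (l : I -> R) :
  (forall i, f i k @[k --> \oo] --> l i) ->
  \sum_i f i k @[k --> \oo] --> \sum_i l i.
Proof. by move=> fl; apply: cvg_big => //; exact: add_continuous. Qed.

(** The transition matrix of the chain killed on its arrival at [j]. *)
Definition killed (R : realType) (n : nat) (P : 'M[R]_n) (j : 'I_n) : 'M[R]_n :=
  \matrix_(a, b) (P a b *+ (b != j)).

Lemma killed_ge0 (R : realType) (n : nat) (P : 'M[R]_n) (j : 'I_n) :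
  stochastic P -> forall a b, 0 <= killed P j a b.
Proof. by move=> [P0 _] a b; rewrite mxE mulrn_wge0. Qed.

Lemma killed_mul (R : realType) (n : nat) (P : 'M[R]_n) (j : 'I_n)
    (x : 'cV[R]_n) :
  killed P j *m x = P *m x - x j 0 *: col j P.
Proof.
apply/colP => a; rewrite !mxE (bigD1 j) //= [in RHS](bigD1 j) //=.
rewrite !mxE eqxx mulr0n mul0r add0r (mulrC (x j 0)) addrAC subrr add0r.
by apply: eq_bigr => b bj; rewrite mxE bj.
Qed.

(** Pairing [x = killed P j *m x] with the stationary vector leaves
    [0 = x j * p j], so [x] vanishes at [j] and is harmonic for [P]. *)
Lemma killed_unit (R : realType) (n : nat) (P : 'M[R]_n) (p : 'rV[R]_n)
    (j : 'I_n) :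
  stochastic P -> irreducible_mx P -> stationary P p ->
  1%:M - killed P j \in unitmx.
Proof.
move=> sP irrP stp; have [_ _ pP] := stp.
apply: unitmx_inj_col => x; rewrite mulmxBl mul1mx killed_mul => /eqP.
rewrite subr_eq0 => /eqP xE.
have pc : p *m col j P = (p 0 j)%:M.
  apply/matrixP => a b; rewrite !ord1 -[in RHS]pP !mxE mulr1n.
  by apply: eq_bigr => k _; rewrite mxE.
have xj0 : x j 0 = 0.
  have /matrixP/(_ 0 0) := congr1 (mulmx p) xE.
  rewrite mulmxBr mulmxA pP -scalemxAr pc [RHS]mxE [X in _ + X]mxE.
  rewrite [X in _ - X]mxE [X in _ * X]mxE mulr1n => pxE.
  have /eqP : x j 0 * p 0 j = 0 by lra.
  by rewrite mulf_eq0 orbC gt_eqF ?(stationary_gt0 sP irrP stp) //= => /eqP.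
apply/colP => i; rewrite [RHS]mxE -xj0.
apply: (harmonic_const sP irrP).
by rewrite {2}xE xj0 scale0r subr0.
Qed.

(** The survival probabilities [killed P j ^+ k *m ones] decrease with [k];
    their limit is fixed by [killed P j], hence zero. *)
Lemma killed_pow_cvg0 (R : realType) (n : nat) (P : 'M[R]_n) (p : 'rV[R]_n)
    (j : 'I_n) :
  stochastic P -> irreducible_mx P -> stationary P p ->
  forall a b, (killed P j ^+ k) a b @[k --> \oo] --> 0.
Proof.
move=> sP irrP stp; set D := killed P j.
have Dk0 : forall k a b, 0 <= (D ^+ k) a b by exact/mxpow_ge0/killed_ge0.
pose u (a : 'I_n) : R^nat := fun k => \sum_b (D ^+ k) a b.
have uS a k : u a k.+1 = \sum_b D a b * u b k.
  rewrite /u exprS -mulmxE; under eq_bigr do rewrite mxE.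
  by rewrite exchange_big; apply: eq_bigr => b _; rewrite mulr_sumr.
have u_decr a : nonincreasing_seq (u a).
  apply/nonincreasing_seqP => k.
  rewrite /u exprSr -mulmxE; under eq_bigr do rewrite mxE.
  rewrite exchange_big; apply: ler_sum => b _.
  rewrite -mulr_sumr ler_piMr // -(row_sum_stochastic sP b).
  apply: ler_sum => c _; rewrite mxE; case: (c != j) => //.
  by case: sP => P0 _; exact: P0.
have u_lb a : has_lbound (range (u a)).
  by exists 0 => _ [k _ <-]; apply: sumr_ge0 => b _.
pose l := \col_a inf (range (u a)).
have u_cvg a : u a k @[k --> \oo] --> l a 0.
  by rewrite mxE; apply: nonincreasing_cvgn.
have lD : D *m l = l.
  apply/colP => a; rewrite mxE.
  have cvg1 : u a k.+1 @[k --> \oo] --> l a 0.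
    by have := u_cvg a; rewrite -(cvg_shiftS (u a)).
  have cvg2 : u a k.+1 @[k --> \oo] --> \sum_b D a b * l b 0.
    under eq_cvg do rewrite uS.
    by apply: cvg_fin_sum => b; apply: cvgMl_tmp.
  exact: (cvg_unique _ cvg2 cvg1).
have l0 : l = 0.
  have /(can_inj (mulKmx (killed_unit j sP irrP stp))) :
    (1%:M - D) *m l = (1%:M - D) *m 0 :> 'cV_n; last by [].
  by rewrite mulmx0 mulmxBl mul1mx lD subrr.
move=> a b; apply: (@squeeze_cvgr _ _ _ _ (fun=> 0) (u a)).
- near=> k; rewrite Dk0 /= /u (bigD1 b) //= lerDl.
  by apply: sumr_ge0 => c _.
- exact: cvg_cst.
- by have := u_cvg a; rewrite l0 mxE.
Unshelve. all: by end_near.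
Qed.

(** With [y] the claimed sum, [r = y - D *m y] makes the partial sums telescope
    to [y - D ^+ N *m y]. *)
Lemma killed_series_cvg (R : realType) (n : nat) (P : 'M[R]_n) (p : 'rV[R]_n)
    (j : 'I_n) :
  stochastic P -> irreducible_mx P -> stationary P p ->
  forall (r : 'cV[R]_n) i,
  (\sum_(0 <= k < N) (killed P j ^+ k *m r) i 0) @[N --> \oo] -->
    (invmx (1%:M - killed P j) *m r) i 0.
Proof.
move=> sP irrP stp r i; set D := killed P j; set y := _ *m r.
have rE : r = y - D *m y.
  rewrite -[X in X - _]mul1mx -mulmxBl mulKVmx //.
  exact: killed_unit sP irrP stp.
have sumE N : \sum_(0 <= k < N) (D ^+ k *m r) i 0 = y i 0 - (D ^+ N *m y) i 0.
  elim: N => [|N IH]; first by rewrite big_geq // expr0 mul1mx subrr.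
  rewrite big_nat_recr //= IH {1}rE mulmxBr (mulmxA _ D).
  have -> : D ^+ N *m D = D ^+ N.+1 by rewrite exprSr mulmxE.
  by rewrite [X in _ + X]mxE [X in _ + (_ + X)]mxE addrA addrNK.
under eq_cvg do rewrite sumE.
have Dy0 : (D ^+ N *m y) i 0 @[N --> \oo] --> (0 : R).
  have -> : 0 = \sum_a 0 * y a 0 :> R by rewrite big1 // => a _; rewrite mul0r.
  under eq_cvg do rewrite mxE.
  apply: cvg_fin_sum => a; apply: cvgMr_tmp.
  exact: (killed_pow_cvg0 _ sP irrP stp).
have : (y i 0 - (D ^+ N *m y) i 0) @[N --> \oo] --> y i 0 - 0.
  by apply: cvgB => //; exact: cvg_cst.
by rewrite subr0.
Qed.

(** * The trace of the fundamental matrix *)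

Lemma ones_mulmx (R : realType) (n m : nat) (q : 'rV[R]_m) (i : 'I_n)
    (j : 'I_m) :
  (ones R n *m q) i j = q 0 j.
Proof. by rewrite mxE big_ord1 mxE mul1r. Qed.

Section KemenyAlgebra.
Context (R : realType) (n : nat) (P : 'M[R]_n) (p : 'rV[R]_n).
Hypotheses (sP : stochastic P) (irrP : irreducible_mx P)
  (stp : stationary P p).

Let Z := fundamental_mx P p.
Let A := 1%:M - P + ones R n *m p.

Let pP : p *m P = p. Proof. by case: stp. Qed.

Let ZA : Z *m A = 1%:M. Proof. exact/mulVmx/fundamental_unit. Qed.

Let AZ : A *m Z = 1%:M. Proof. exact/mulmxV/fundamental_unit. Qed.

Lemma fundamental_ones : Z *m ones R n = ones R n.
Proof.
have A1 : A *m ones R n = ones R n.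
  rewrite mulmxDl mulmxBl mul1mx (proj2 sP) subrr add0r -mulmxA.
  by rewrite (stationary_ones stp) mulmx1.
by rewrite -[in LHS]A1 mulmxA ZA mul1mx.
Qed.

Lemma stationary_fundamental : p *m Z = p.
Proof.
have pA : p *m A = p.
  rewrite mulmxDr mulmxBr mulmx1 pP subrr add0r mulmxA.
  by rewrite (stationary_ones stp) mul1mx.
by rewrite -[in LHS]pA -mulmxA AZ mulmx1.
Qed.

Lemma fundamental_mulP : Z *m P = Z - 1%:M + ones R n *m p.
Proof.
have := ZA; rewrite mulmxDr mulmxBr mulmx1 mulmxA fundamental_ones.
move: (Z *m P) (ones R n *m p) (Z) => U V W /matrixP UVW.
by apply/matrixP => a b; have := UVW a b; rewrite !mxE; lra.
Qed.

(** For a solution [y] of the first passage equation [y = r + killed P j *m y],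
    that is [(1 - P) y = r - y j *: col j P], multiplication by [p] gives
    [y j * p j = p r], and multiplication by [Z] gives
    [p y = y j * Z j j + y j * p j - (Z r) j]. *)
Lemma first_passage_stationary (r : 'cV[R]_n) (j : 'I_n) (y : 'cV[R]_n) :
  y = r + killed P j *m y ->
  (p *m y) 0 0 * p 0 j =
    (p *m r) 0 0 * Z j j + (p *m r) 0 0 * p 0 j - p 0 j * (Z *m r) j 0.
Proof.
rewrite killed_mul => yE.
have yj_pj : y j 0 * p 0 j = (p *m r) 0 0.
  have := congr1 (fun v => (p *m v) 0 0) yE.
  rewrite /= mulmxDr mulmxBr mulmxA pP -scalemxAr colE mulmxA pP -colE.
  rewrite [in RHS]mxE [X in _ + X]mxE [X in _ + (_ + X)]mxE [X in _ - X]mxE.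
  by rewrite [X in _ * X]mxE; lra.
have yjE : y j 0 = (Z *m r) j 0 - y j 0 * (Z j j - 1 + p 0 j) + (p *m y) 0 0.
  have Ay : A *m y = r - y j 0 *: col j P + ones R n *m (p *m y).
    rewrite mulmxDl mulmxBl mul1mx -mulmxA; congr (_ + _).
    by rewrite {1}yE addrA addrAC addrK.
  have := congr1 (fun v => (Z *m v) j 0) Ay.
  rewrite /= mulmxA ZA mul1mx mulmxDr mulmxBr (mulmxA Z (ones R n)).
  rewrite fundamental_ones -scalemxAr colE (mulmxA Z P) fundamental_mulP -colE.
  move=> E; rewrite {1}E mxE ones_mulmx mxE; congr (_ + _ + _).
  have I1 : (- 1%:M : 'M[R]_n) j j = - 1 by rewrite !mxE eqxx.
  by rewrite mxE mxE mxE mxE mxE I1 ones_mulmx.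
have := congr1 ( *%R (p 0 j)) yjE.
by rewrite -yj_pj; lra.
Qed.

(** Since [p] is fixed by [Z], the terms [(p r) p(j)] and [p(j) (Z r)(j)] have
    the same sum over [j]. *)
Lemma kemeny_algebra (r : 'cV[R]_n) (y : 'I_n -> 'cV[R]_n) :
  (forall j, y j = r + killed P j *m y j) ->
  \sum_i \sum_j p 0 i * y j i 0 * p 0 j = \tr Z * (p *m r) 0 0.
Proof.
move=> yE; rewrite exchange_big /=.
under eq_bigr => j _.
  rewrite -mulr_suml (_ : \sum_i _ = (p *m y j) 0 0); last by rewrite mxE.
  rewrite (first_passage_stationary (yE j)); over.
rewrite sumrB big_split /= -!mulr_sumr.
have [_ p1 _] := stp; rewrite p1 mulr1.
rewrite (_ : \sum_i p 0 i * _ = (p *m r) 0 0); last first.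
  by rewrite -{2}stationary_fundamental -mulmxA [in RHS]mxE.
by rewrite addrK mulrC.
Qed.

End KemenyAlgebra.

(** * Integration of a variable independent of an event *)

Lemma integral_mrestr (R : realType) (d : measure_display)
    (T : measurableType d) (mu : {measure set T -> \bar R}) (A : set T)
    (mA : measurable A) (f : T -> \bar R) :
  measurable_fun setT f -> (forall t, 0 <= f t)%E ->
  (\int[mrestr mu mA]_t f t = \int[mu]_(t in A) f t)%E.
Proof.
move=> mf f0; rewrite -(setUv A) ge0_integral_setU //=.
- rewrite [X in (_ + X)%E]null_set_integral ?adde0 //.
  + apply: eq_measure_integral => B _ BA.
    by rewrite /= /mrestr setIidl.
  + exact: measurableC.
  + exact: measurable_funTS.
  + by rewrite /= /mrestr setICl measure0.
- exact: measurableC.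
- exact: measurable_funTS.
- by apply/disj_setPS; rewrite setICr.
Qed.

(** The measures that [mrestr Pr A] pushes forward along [f] and
    [Pr A * Q] along [g] agree. They integrate the absolute value rather than the
    identity of the real line because it is nonnegative everywhere. *)
Lemma integral_indep (R : realType) (d d' : measure_display)
    (T : measurableType d') (Pr : probability T R)
    (S : measurableType d) (Q : probability S R)
    (A : set T) (f : {mfun T >-> R}) (g : {RV Q >-> R}) :
  measurable A -> (forall t, 0 <= f t) -> (forall s, 0 <= g s) ->
  (forall B, measurable B ->
    Pr (A `&` f @^-1` B) = (Pr A * Q (g @^-1` B))%E) ->
  (\int[Pr]_(t in A) (f t)%:E = Pr A * 'E_Q[g])%E.
Proof.
move=> mA f0 g0 fg; pose phi (y : R) : \bar R := `|y|%:E.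
have mphi : measurable_fun setT phi.
  by apply/measurable_EFinP; exact: normr_measurable.
have phi0 y : (0 <= phi y)%E by rewrite lee_fin.
have Pr_fin : Pr A \is a fin_num by rewrite fin_num_measure.
have PrA0 : 0 <= fine (Pr A) by rewrite fine_ge0.
pose c : {nonneg R} := NngNum PrA0.
rewrite -(integral_mrestr Pr mA); first last.
- by move=> t; rewrite lee_fin.
- by apply/measurable_EFinP; exact: measurable_funP.
transitivity (\int[pushforward (mrestr Pr mA) f]_y phi y)%E.
  rewrite ge0_integral_pushforward //.
  by apply: eq_integral => t _; rewrite /phi /= ger0_norm.
transitivity (\int[mscale c (distribution Q g)]_y phi y)%E.
  apply: eq_measure_integral => B mB _.
  by rewrite /= /mscale /distribution /pushforward /mrestr /= setIC fg // fineK.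
rewrite ge0_integral_mscale // ge0_integral_distribution //= fineK //.
congr (_ * _)%E; rewrite unlock; apply: eq_integral => s _.
by rewrite /phi /= ger0_norm.
Qed.

(** * Events on the trajectory of the chain *)

(** Each of the first positions is constrained separately. This family of
    events is stable under fixing one more position ([pin]), which is what the
    inductions over positions below rely on. *)
Definition path_event (n : nat) (T : Type) (X : nat -> T -> 'I_n)
    (C : nat -> pred 'I_n) (k : nat) : set T :=
  [set t | forall m, (m <= k)%N -> C m (X m t)].

Definition pin (n : nat) (l : nat) (c : 'I_n) (C : nat -> pred 'I_n) :
    nat -> pred 'I_n :=
  fun m x => C m x && ((m == l) ==> (x == c)).

Lemma pinC (n : nat) (l l' : nat) (c c' : 'I_n) (C : nat -> pred 'I_n) :
  pin l c (pin l' c' C) = pin l' c' (pin l c C).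
Proof. by apply/funext => m; apply/funext => x; rewrite /pin andbAC. Qed.

Lemma path_eventE (n : nat) (T : Type) (X : nat -> T -> 'I_n)
    (C : nat -> pred 'I_n) (k : nat) :
  path_event X C k =
  \bigcap_(m in [set m | (m <= k)%N])
    \bigcup_(a in [set a | C m a]) X m @^-1` [set a].
Proof.
apply/seteqP; split=> t Ct m mk; first by exists (X m t) => //; exact: Ct.
by have [a Ca /= ->] := Ct m mk.
Qed.

Lemma path_event_measurable (n : nat) (d : measure_display)
    (T : measurableType d) (X : nat -> T -> 'I_n) :
  (forall m a, measurable (X m @^-1` [set a])) ->
  forall C k, measurable (path_event X C k).
Proof.
move=> mX C k; rewrite path_eventE; apply: bigcap_measurableType => m _.
by apply: fin_bigcup_measurable => // a _; exact: mX.
Qed.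

Lemma path_event_chain_sigma (n : nat) (T : pointedType) (X : nat -> T -> 'I_n)
    (C : nat -> pred 'I_n) (k : nat) :
  chain_sigma X (path_event X C k).
Proof.
pose G := [set A | exists k a, A = X k @^-1` [set a]].
have mX m a : (G.-sigma).-measurable
    (X m @^-1` [set a] : set (g_sigma_algebraType G)).
  by apply: sub_sigma_algebra; exists m, a.
exact: (path_event_measurable (T := g_sigma_algebraType G) mX).
Qed.

Lemma path_event_split (R : realType) (n : nat) (d : measure_display)
    (T : measurableType d) (Pr : probability T R)
    (X : nat -> T -> 'I_n) (l : nat) (C : nat -> pred 'I_n) (k : nat) :
  (forall m a, measurable (X m @^-1` [set a])) -> (l <= k)%N ->
  Pr (path_event X C k) = (\sum_c Pr (path_event X (pin l c C) k))%E.
Proof.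
move=> mX lk; rewrite -(measure_bigsetU_ord Pr xpredT); first last.
- move=> c c' _ _ [t [tc tc']].
  have := tc l lk; have := tc' l lk; rewrite /pin eqxx /=.
  by move=> /andP[_ /eqP <-] /andP[_ /eqP].
- by move=> c; exact: path_event_measurable.
congr (Pr _); rewrite -bigcup_seq; apply/seteqP; split=> [t Ct|t [c _ ct] m mk].
  exists (X l t) => /=; first by rewrite mem_index_enum.
  move=> m mk; rewrite /pin Ct //=.
  by apply/implyP => /eqP ->.
by have /andP[] := ct m mk.
Qed.

(** Each [C m] with [m <= k] allows at most the value [x m]. Either it allows
    it for all [m], and the event is a single trajectory, or both events are
    empty. *)
Lemma path_event_step_singletons (R : realType) (n : nat)
    (d : measure_display) (T : measurableType d) (Pr : probability T R)
    (P : 'M[R]_n) (i : 'I_n) (X : nat -> T -> 'I_n) :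
  markov_chain_from Pr P i X ->
  forall k b (C : nat -> pred 'I_n) (x : nat -> 'I_n),
  (forall m c, (m <= k)%N -> C m c -> c = x m) -> (forall c, C k.+1 c) ->
  Pr (path_event X (pin k.+1 b C) k.+1) =
    (Pr (path_event X C k) * (P (x k) b)%:E)%E.
Proof.
move=> [_ _ step] k b C x Cx Ck.
have pinE m c : (m <= k)%N -> pin k.+1 b C m c = C m c.
  by move=> mk; rewrite /pin ltn_eqF ?andbT.
have [|] := EM (forall m, (m <= k)%N -> C m (x m)) => [C1|CN].
  pose x' m := if m == k.+1 then b else x m.
  have x'E m : (m <= k)%N -> x' m = x m by move=> mk; rewrite /x' ltn_eqF.
  have := step k x'; rewrite /x' eqxx (ltn_eqF (ltnSn k)) => stepk.
  transitivity (Pr [set t | forall m, (m <= k.+1)%N -> X m t = x' m]).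
    congr (Pr _); apply/seteqP; split=> t tC m.
      rewrite leq_eqVlt ltnS => /orP[/eqP->|mk].
        by have := tC k.+1 (leqnn _); rewrite /pin /x' eqxx => /andP[_ /eqP].
      rewrite x'E //; apply: Cx => //.
      by have := tC m (leqW mk); rewrite pinE.
    rewrite leq_eqVlt ltnS => /orP[/eqP->|mk].
      by rewrite (tC k.+1 (leqnn _)) /x' /pin Ck !eqxx.
    by rewrite (tC m (leqW mk)) x'E // pinE // C1.
  rewrite stepk; congr (Pr _ * _)%E; apply/seteqP; split=> t tC m mk.
    by rewrite (tC m mk) [if _ then _ else _](x'E m mk) C1.
  by rewrite [RHS](x'E m mk); apply: Cx => //; exact: tC.
have emp A : (forall t, A t -> forall m, (m <= k)%N -> C m (X m t)) ->
    Pr A = 0%E.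
  move=> AC; rewrite (_ : A = set0) ?measure0 //.
  rewrite -subset0 => t At; apply: CN => m mk.
  by have Cm := AC t At m mk; rewrite -(Cx m _ mk Cm).
rewrite !emp ?mul0e // => t tC m mk; have := tC m; rewrite ?pinE //.
by apply; exact: leqW.
Qed.

(** The Markov property for events that constrain each of the first [k]
    positions only by a set: pinning these positions one at a time reduces it
    to single trajectories. *)
Lemma path_event_step (R : realType) (n : nat)
    (d : measure_display) (T : measurableType d) (Pr : probability T R)
    (P : 'M[R]_n) (i : 'I_n) (X : nat -> T -> 'I_n) :
  markov_chain_from Pr P i X ->
  forall k a b (C : nat -> pred 'I_n), (forall c, C k.+1 c) ->
  Pr (path_event X (pin k.+1 b (pin k a C)) k.+1) =
    (Pr (path_event X (pin k a C) k) * (P a b)%:E)%E.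
Proof.
move=> mc k a b.
suff gen l : (l <= k)%N -> forall (C : nat -> pred 'I_n) (x : nat -> 'I_n),
    (forall m c, (l <= m <= k)%N -> C m c -> c = x m) ->
    (forall c, C k.+1 c) ->
    Pr (path_event X (pin k.+1 b C) k.+1) =
      (Pr (path_event X C k) * (P (x k) b)%:E)%E.
  move=> C Ck; apply: (gen k (leqnn k) _ (fun=> a)) => [m c|c].
    by rewrite -eqn_leq /pin eq_sym => /eqP-> /andP[_]; rewrite eqxx => /eqP.
  by rewrite /pin Ck gtn_eqF.
elim: l => [|l IH] lk C x Cx Ck.
  by apply: (path_event_step_singletons mc) => // m c mk; exact: Cx.
have mX := mc_measurable mc.
rewrite (path_event_split Pr _ mX (ltnW (leqW lk) : l <= k.+1)%N).
rewrite (path_event_split Pr C mX (ltnW lk)).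
rewrite ge0_sume_distrl; last by move=> c _; exact: measure_ge0.
apply: eq_bigr => c _; rewrite pinC.
pose x' m := if m == l then c else x m.
rewrite (IH (ltnW lk) (pin l c C) x').
- by rewrite /x' gtn_eqF.
- move=> m c'; rewrite leq_eqVlt /pin /x' (eq_sym l).
  case: eqVneq => /= [_ _ /andP[_ /eqP //]|_ lmk /andP[Cm _]].
  exact: Cx.
- by move=> c'; rewrite /pin Ck gtn_eqF // leqW.
Qed.

(** The constraint of being away from [j] at the times [1, ..., k]: the start,
    at time [0], does not count as a passage. *)
Definition avoid (n : nat) (j : 'I_n) (k : nat) : nat -> pred 'I_n :=
  fun m c => (0 < m <= k)%N ==> (c != j).

(** The chain is at [b] at time [k.+1] and has avoided [j] if and only if
    [b != j], it had avoided [j] until time [k], and it moved from some [a] to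
    [b]: this is the recursion of the powers of [killed P j]. *)
Lemma avoid_prob (R : realType) (n : nat)
    (d : measure_display) (T : measurableType d) (Pr : probability T R)
    (P : 'M[R]_n) (i : 'I_n) (X : nat -> T -> 'I_n) (j : 'I_n) :
  markov_chain_from Pr P i X ->
  forall k a, Pr (path_event X (pin k a (avoid j k)) k) =
    ((killed P j ^+ k) i a)%:E.
Proof.
move=> mc; have mX := mc_measurable mc.
elim=> [|k IH] b.
  have -> : path_event X (pin 0 b (avoid j 0)) 0 =
      X 0%N @^-1` [set b].
    apply/seteqP; split=> t; first by move/(_ 0%N (leqnn _)) => /eqP.
    move=> /= tb m; rewrite leqn0 => /eqP m0.
    by rewrite m0 tb /pin /avoid /= eqxx.
  have := mc_init mc; rewrite expr0 mxE.
  case: (eqVneq i b) => [<- -> //|ib Pri].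
  have PrC : Pr (~` (X 0%N @^-1` [set i])) = 0%E.
    by rewrite probability_setC // Pri subee.
  apply/eqP; rewrite eq_le measure_ge0 andbT /= -[leRHS]PrC.
  apply: le_measure; rewrite ?inE //; first exact: measurableC.
  by move=> t /= -> /esym/eqP; apply/negP.
rewrite exprSr -mulmxE mxE.
have [->|bj] := eqVneq b j.
  rewrite big1 => [|a _]; last by rewrite mxE eqxx mulr0.
  rewrite (_ : path_event _ _ _ = set0) ?measure0 // -subset0 => t.
  move/(_ k.+1 (leqnn _)); rewrite /pin /avoid eqxx ltnSn /=.
  by case/andP => /negbTE ->.
have -> : path_event X (pin k.+1 b (avoid j k.+1)) k.+1 =
    path_event X (pin k.+1 b (avoid j k)) k.+1.
  apply/seteqP; split=> t tC m mk; have := tC m mk; rewrite /pin /avoid.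
    by case/andP => Hm ->; rewrite andbT; apply: contraTT Hm => /=;
       rewrite !negb_imply => /andP[/andP[-> /leqW ->] ->].
  case/andP => Hm Hb; rewrite Hb andbT.
  have [mk1|mk1] := eqVneq m k.+1; last first.
    apply/implyP => /andP[m0 _]; apply: (implyP Hm).
    by rewrite m0 -ltnS ltn_neqAle mk1.
  by move: Hb; rewrite mk1 eqxx => /eqP->; rewrite bj implybT.
rewrite (path_event_split Pr _ mX (leqnSn k)) -sumEFin.
apply: eq_bigr => a _; rewrite pinC (path_event_step mc).
  by rewrite IH mxE bj mulr1n EFinM.
by move=> c; rewrite /avoid ltnn andbF.
Qed.

Lemma le_hitting_time (R : realType) (n : nat) (T : Type)
    (X : nat -> T -> 'I_n) (j : 'I_n) (t : T) (k : nat) :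
  ((k.+1%:R)%:E <= hitting_time R X j t)%E =
  `[< forall m, (0 < m <= k)%N -> X m t != j >].
Proof.
apply/idP/asboolP => [kj m /andP[m0 mk]|Xj].
  apply/eqP => Xm.
  have : (k.+1%:R%:E <= (m%:R : R)%:E)%E.
    by apply: (le_trans kj); apply: ereal_inf_lbound; exists m.
  by rewrite lee_fin ler_nat ltnNge mk.
apply: le_ereal_inf_tmp => _ [m [m0 Xm] <-].
rewrite lee_fin ler_nat ltnNge; apply/negP => mk.
by have := Xj m; rewrite m0 mk Xm eqxx => /(_ isT).
Qed.

(** * Mean first passage weights *)

(** The event that the transition at time [k.+1] is the edge [ab] and is made
    before or at the first passage to [j]. *)
Definition passage_edge (n : nat) (T : Type) (X : nat -> T -> 'I_n)
    (j : 'I_n) (k : nat) (ab : 'I_n * 'I_n) : set T :=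
  path_event X (pin k.+1 ab.2 (pin k ab.1 (avoid j k))) k.+1.

Lemma passage_edgeE (n : nat) (T : Type) (X : nat -> T -> 'I_n)
    (j : 'I_n) (k : nat) (ab : 'I_n * 'I_n) (t : T) :
  (t \in passage_edge X j k ab) =
  `[< forall m, (0 < m <= k)%N -> X m t != j >] && (ab == (X k t, X k.+1 t)).
Proof.
apply/idP/andP => [/set_mem tA|[/asboolP Xj /eqP ->]].
  split.
    apply/asboolP => m mk; have /andP[_ mk'] := mk.
    have := tA m (leqW mk').
    by rewrite /pin /avoid mk /= => /andP[/andP[-> _] _].
  case: ab tA => a b tA.
  have := tA k (leqnSn k); have := tA k.+1 (leqnn _); rewrite /pin !eqxx /=.
  by move=> /andP[_ /eqP <-] /andP[/andP[_ /eqP <-] _].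
apply/mem_set => m mk; rewrite /pin /=; apply/andP; split; last first.
  by apply/implyP => /eqP ->.
apply/andP; split; last by apply/implyP => /eqP ->.
by apply/implyP; exact: Xj.
Qed.

(** At each time exactly one pair [ab] is traversed. Splitting the collected
    weight according to this pair separates the weights, which are independent
    of the chain, from the events of the chain. *)
Lemma weighted_hitting_timeE (R : realType) (n : nat) (T : Type)
    (X : nat -> T -> 'I_n) (w : nat -> 'I_n -> 'I_n -> T -> R) (j : 'I_n)
    (t : T) :
  (forall k a b, 0 <= w k a b t) ->
  (weighted_hitting_time X w j t =
   \sum_(k <oo) \sum_(ab : 'I_n * 'I_n)
     ((fun t => (w k.+1 ab.1 ab.2 t)%:E) \_ (passage_edge X j k ab)) t)%E.
Proof.
move=> w0; rewrite /weighted_hitting_time eseries_mkcond -nneseries_addn.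
  apply: eq_eseriesr => k _; rewrite addn1 le_hitting_time /= /patch.
  have [Xj|Xj] := boolP `[< _ >].
    rewrite (bigD1 (X k t, X k.+1 t)) //= passage_edgeE Xj eqxx /=.
    rewrite big1 ?adde0 // => ab abX.
    by rewrite passage_edgeE (negbTE abX) andbF.
  by rewrite big1 // => ab _; rewrite passage_edgeE (negbTE Xj).
by move=> k; case: ifP; rewrite ?lee_fin.
Qed.

Lemma wmg_stochastic (R : realType) (n : nat)
    (d : measure_display) (S : measurableType d) (Q : probability S R)
    (E : {set 'I_n * 'I_n}) (P : 'M[R]_n) (eps : R)
    (wt : 'I_n -> 'I_n -> {RV Q >-> R}) :
  weighted_markovian_graph E P eps wt -> stochastic P.
Proof.
move=> hG; apply: stochastic_row_sum; last exact: wmg_row_sum hG.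
move=> a b; have [abE|abE] := boolP ((a, b) \in E).
  exact: (wmg_ge0 hG).
by rewrite (wmg_eq0 hG).
Qed.

Lemma weights_ge0 (R : realType) (n : nat) (E : {set 'I_n * 'I_n}) (eps : R)
    (U : Type) (v : 'I_n -> 'I_n -> U -> R) :
  0 <= eps -> weights_range E eps v -> forall a b u, 0 <= v a b u.
Proof.
move=> eps0 rv a b u; have [vE vN] := rv a b u.
have [/vE|/vN->//] := boolP ((a, b) \in E).
exact: le_trans.
Qed.

(** The [k]-th term of the series has mean [(killed P j ^+ k *m r) i 0], where
    [r] is the vector of the mean weights of one step. *)
Lemma mean_first_passageE (R : realType) (n : nat)
    (E : {set 'I_n * 'I_n}) (P : 'M[R]_n) (eps : R)
    (d : measure_display) (S : measurableType d) (Q : probability S R)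
    (wt : 'I_n -> 'I_n -> {RV Q >-> R}) (p : 'rV[R]_n)
    (d' : measure_display) (T : measurableType d')
    (Pr : 'I_n -> probability T R)
    (X : nat -> T -> 'I_n) (w : nat -> 'I_n -> 'I_n -> {mfun T >-> R}) :
  weighted_markovian_graph E P eps wt -> assumption_A E P wt p ->
  (forall i, weighted_chain_from E P eps wt (Pr i) i X w) ->
  forall i j, mean_first_passage Pr X w i j =
    ((invmx (1%:M - killed P j) *m
       (map2_mx *%R P (mean_weights wt) *m ones R n)) i 0)%:E.
Proof.
move=> hG hA hX i j.
have sP := wmg_stochastic hG; have eps0 := ltW (wmg_eps_gt0 hG).
have wt0 := weights_ge0 eps0 (wmg_range hG).
have w0 k := weights_ge0 eps0 (wc_range (hX i) k).
have mc := wc_chain (hX i); have mX := mc_measurable mc.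
have mA k ab : measurable (passage_edge X j k ab).
  exact: path_event_measurable.
have mw k ab : measurable_fun setT
    ((fun t => (w k.+1 ab.1 ab.2 t)%:E) \_ (passage_edge X j k ab)).
  apply: (proj1 (measurable_restrictT _ (mA k ab))); apply: measurable_funTS.
  by apply/measurable_EFinP; exact: measurable_funP.
have w0A k ab t :
    (0 <= ((fun t => (w k.+1 ab.1 ab.2 t)%:E) \_ (passage_edge X j k ab)) t)%E.
  by apply: erestrict_ge0 => u _; rewrite lee_fin.
have Ewt a b : ('E_Q[wt a b] = (mean_weights wt a b)%:E)%E.
  rewrite mxE fineK //; have [abE|abE] := boolP ((a, b) \in E).
    by rewrite ge0_fin_numE ?(asA_mean hA) //; exact: expectation_ge0.
  (* Off the edges the weight vanishes, so its mean is finite there too. *)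
  rewrite (_ : 'E_Q[wt a b] = 0)%E // unlock integral0_eq // => s _.
  by have [_ ->] := wmg_range hG a b s.
rewrite /mean_first_passage.
under eq_integral => t _ do rewrite weighted_hitting_timeE //.
rewrite integral_nneseries //; last 2 first.
- by move=> k; apply: emeasurable_sum => ab; exact: mw.
- by move=> k t _; apply: sume_ge0.
have term k : (\int[Pr i]_t \sum_(ab : 'I_n * 'I_n)
     ((fun t => (w k.+1 ab.1 ab.2 t)%:E) \_ (passage_edge X j k ab)) t)%E =
   ((killed P j ^+ k *m
       (map2_mx *%R P (mean_weights wt) *m ones R n)) i 0)%:E.
  rewrite ge0_integral_sum //.
  transitivity (\sum_(ab : 'I_n * 'I_n)
     ((killed P j ^+ k) i ab.1 *
        (P ab.1 ab.2 * mean_weights wt ab.1 ab.2))%:E)%E.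
    apply: eq_bigr => ab _; rewrite -integral_mkcond.
    rewrite (@integral_indep _ _ _ _ (Pr i) _ Q _ _ (wt ab.1 ab.2)) //.
      rewrite (path_event_step mc) ?(avoid_prob _ mc) ?Ewt -?EFinM ?mulrA //.
      by move=> c; rewrite /avoid ltnn andbF.
    move=> B mB; rewrite (wc_indep (hX i)).
    - by rewrite (wc_law (hX i)).
    - exact: path_event_chain_sigma.
    - by apply: sub_sigma_algebra; exists k.+1, ab.1, ab.2, B.
  rewrite sumEFin; congr (_%:E); rewrite mxE.
  rewrite -(pair_bigA _ (fun a b => (killed P j ^+ k) i a *
        (P a b * mean_weights wt a b))) /=.
  apply: eq_bigr => a _; rewrite mxE -mulr_sumr; congr (_ * _).
  by apply: eq_bigr => b _; rewrite !mxE mulr1.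
under eq_eseriesr do rewrite term.
have := @killed_series_cvg _ _ _ _ j sP (wmg_irreducible hG)
  (asA_stationary hA) (map2_mx *%R P (mean_weights wt) *m ones R n) i.
move=> cu; apply/cvg_lim => //; under eq_cvg do rewrite sumEFin.
by apply: cvg_EFin; [exact: nearW | exact: cu].
Qed.

Theorem lemma3 (R : realType) (n : nat)
    (E : {set 'I_n * 'I_n}) (P : 'M[R]_n) (eps : R)
    (d : measure_display) (S : measurableType d) (Q : probability S R)
    (wt : 'I_n -> 'I_n -> {RV Q >-> R})
    (hG : weighted_markovian_graph E P eps wt)
    (p : 'rV[R]_n) (hA : assumption_A E P wt p)
    (d' : measure_display) (T : measurableType d')
    (Pr : 'I_n -> probability T R)
    (X : nat -> T -> 'I_n) (w : nat -> 'I_n -> 'I_n -> {mfun T >-> R})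
    (hX : forall i, weighted_chain_from E P eps wt (Pr i) i X w) :
  kemeny p (mean_first_passage Pr X w) =
  (\tr (fundamental_mx P p) *
     (p *m map2_mx *%R P (mean_weights wt) *m ones R n) 0 0)%:E.
Proof.
have sP := wmg_stochastic hG.
have irrP := wmg_irreducible hG; have stp := asA_stationary hA.
rewrite -mulmxA; set r := map2_mx _ _ _ *m _.
rewrite -(kemeny_algebra sP irrP stp (r := r)
  (y := fun j => invmx (1%:M - killed P j) *m r)); last first.
  move=> j; set y := _ *m r.
  rewrite -[X in X + _](mulKVmx (killed_unit j sP irrP stp)).
  by rewrite mulmxBl mul1mx subrK.
rewrite -sumEFin; apply: eq_bigr => i _; rewrite -sumEFin.
by apply: eq_bigr => j _; rewrite (mean_first_passageE hG hA hX) !EFinM.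
Qed.
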